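(* Let $n\ge2$ and $1\le k\le n-1$ be integers. As $u=(u_1,\dots,u_n)\to0$ in $\mathbb R^n$ subject to $\sum_{i=1}^n u_i=0$, \[ S_{n,k}(e^u)=\frac nk+Q_{n,k}(u)+O(\|u\|^3), \] where, with $L_i=u_{i+1}+\cdots+u_{i+k}$, \[ Q_{n,k}(u)=-\frac1{k^2}\sum_{i=1}^n u_iL_i+\frac1{k^3}\sum_{i=1}^n L_i^2 . \]
   Context: Indices are modulo $n$. For $x_i>0$, $S_{n,k}(x)=\sum_{i=1}^n\frac{x_i}{x_{i+1}+\cdots+x_{i+k}}$, and $e^u=(e^{u_1},\dots,e^{u_n})$. The constant in $O(\cdot)$ may depend on $n$ and $k$. *)

(* Defs.v *)
From mathcomp Require Import all_boot all_order all_algebra.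
From mathcomp Require Import all_classical all_reals all_analysis.
Import Order.TTheory GRing.Theory Num.Theory.
Import numFieldNormedType.Exports.

Set Implicit Arguments.
Unset Strict Implicit.
Unset Printing Implicit Defensive.

Local Open Scope classical_set_scope.
Local Open Scope ring_scope.

Lemma ord_shift_subproof (n : nat) (i : 'I_n) (j : nat) : ((i + j) %% n < n)%N.
Proof. exact: ltn_pmod (leq_ltn_trans (leq0n i) (ltn_ord i)). Qed.

(* The index i + j modulo n; the index set {1, ..., n} is rendered as
   'I_n = {0, ..., n - 1}. *)
Definition ord_shift (n : nat) (i : 'I_n) (j : nat) : 'I_n :=
  Ordinal (ord_shift_subproof i j).

Definition window_sum (R : realType) (n k : nat) (x : 'rV[R]_n) (i : 'I_n) : R :=
  \sum_(1 <= j < k.+1) x 0 (ord_shift i j).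

Definition cyclic_sum (R : realType) (n k : nat) (x : 'rV[R]_n) : R :=
  \sum_(i < n) x 0 i / window_sum k x i.

Definition exp_row (R : realType) (n : nat) (u : 'rV[R]_n) : 'rV[R]_n :=
  \row_i expR (u 0 i).

Definition quadratic_term (R : realType) (n k : nat) (u : 'rV[R]_n) : R :=
  - (k%:R ^+ 2)^-1 * (\sum_(i < n) u 0 i * window_sum k u i)
  + (k%:R ^+ 3)^-1 * (\sum_(i < n) window_sum k u i ^+ 2).

(* The norm of 'rV[R]_n in the library is the sup norm. *)
Definition euclidean_norm (R : realType) (n : nat) (u : 'rV[R]_n) : R :=
  Num.sqrt (\sum_(i < n) u 0 i ^+ 2).

Definition zero_sum (R : realType) (n : nat) : set 'rV[R]_n :=
  [set u | \sum_(i < n) u 0 i = 0].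

(* Main.v *)
(* Let L_i and M_i be the averages of the u_j and of the u_j^2 over the window of
   i, and W_i the average of the e^(u_j).  Up to cubic error in the sup norm,
   e^(u_i) = 1 + u_i + u_i^2/2 and W_i = 1 + L_i + M_i/2, so
   e^(u_i)/W_i = 1 + u_i + u_i^2/2 - L_i - M_i/2 + L_i^2 - u_i L_i.
   Averaging over windows preserves the sum over the cycle: after summation the
   linear terms vanish and u_i^2/2 cancels M_i/2. *)
Require Import Defs.
From mathcomp Require Import all_boot all_order all_algebra.
From mathcomp Require Import all_classical all_reals all_analysis.
From mathcomp Require Import ring lra.
Import Order.TTheory GRing.Theory Num.Theory.
Import numFieldNormedType.Exports.

Local Open Scope classical_set_scope.
Local Open Scope ring_scope.

(** Serves both signs of [x]: the bound [|c| <= |x|] is all that estimates on [df] near 0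
    require. *)
Lemma MVT_from_zero (R : realType) (f df : R -> R) (x : R) :
  (forall y, is_derive y (1 : R) f (df y)) ->
  exists2 c, `|c| <= `|x| & f x - f 0 = df c * x.
Proof.
move=> fdf.
have cf (A : set R) : {within A, continuous f}.
  by apply: continuous_subspaceT => y; apply/differentiable_continuous/derivable1_diffP.
have [x0|x0] := leP 0 x.
- have [//|c] := @MVT_segment R f df 0 x x0.
  rewrite in_itv subr0 /= => /andP[c0 cx] ->; exists c => //.
  by rewrite !ger0_norm.
- have [//|c] := @MVT_segment R f df x 0 (ltW x0).
  rewrite in_itv /= sub0r => /andP[cx c0] e; exists c.
    by rewrite !ler0_norm ?lerN2 // ltW.
  by rewrite -[LHS]opprB e mulrN opprK.
Qed.

(** From [1 + y <= e^y] at [y = x] and [y = -x]: the remainder is nonnegative and at most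
    [1/(1-x) - 1 - x = x^2/(1-x)]. *)
Lemma expR_taylor1 (R : realType) (x : R) :
  `|x| <= 2^-1 -> `|expR x - 1 - x| <= 2 * `|x| ^+ 2.
Proof.
move=> hx; rewrite real_normK ?num_real //.
have [h1 h2] : x <= 2^-1 /\ - x <= 2^-1 by move: hx; rewrite ler_norml; lra.
have lo := expR_ge1Dx x.
have hi : expR x * (1 - x) <= 1.
  rewrite -[leRHS](expRxMexpNx_1 x); apply: ler_wpM2l; first exact: expR_ge0.
  exact: expR_ge1Dx.
rewrite ger0_norm; first by nra.
by lra.
Qed.

(** The quadratic remainder vanishes at 0 and has the linear remainder as its derivative, so the
    mean value theorem raises the order by one. *)
Lemma expR_taylor2 (R : realType) (x : R) :
  `|x| <= 2^-1 -> `|expR x - (1 + x + x ^+ 2 / 2)| <= 2 * `|x| ^+ 3.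
Proof.
move=> hx.
have [|c cx] := @MVT_from_zero R (fun y => expR y - (1 + y + y ^+ 2 / 2))
  (fun y => expR y - 1 - y) x.
  move=> y; apply: is_derive_eq.
  by rewrite /GRing.scale /=; field.
rewrite expR0 expr0n /= => e.
have -> : expR x - (1 + x + x ^+ 2 / 2) = (expR c - 1 - c) * x by rewrite -e; field.
rewrite normrM exprSr mulrA; apply: ler_wpM2r => //.
apply: le_trans (expR_taylor1 _ _ (le_trans cx hx)) _.
by apply: ler_wpM2l => //; apply: lerXn2r; rewrite ?nnegrE.
Qed.

Lemma quotient_taylor2 (R : realType) (x w u l m r : R) :
  r <= 4^-1 -> `|u| <= r -> `|l| <= r -> `|m| <= r ^+ 2 ->
  `|x - (1 + u + u ^+ 2 / 2)| <= 2 * r ^+ 3 ->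
  `|w - (1 + l + m / 2)| <= 2 * r ^+ 3 ->
  `|x / w - (1 + u + u ^+ 2 / 2 - l - m / 2 + l ^+ 2 - u * l)| <= 26 * r ^+ 3.
Proof.
move=> r4 hu hl hm hx hw.
have r0 : 0 <= r := le_trans (normr_ge0 u) hu.
have M (a b A B : R) : `|a| <= A -> `|b| <= B -> `|a * b| <= A * B.
  by move=> ha hb; rewrite normrM; apply: ler_pM.
have r2 : r ^+ 2 <= 16^-1 by nra.
have r3 : r ^+ 3 <= 64^-1 by rewrite exprS; nra.
have r30 : 0 <= r ^+ 3 by exact: exprn_ge0.
have r43 : r ^+ 4 <= 4^-1 * r ^+ 3 by rewrite exprS; nra.
have w2 : 2^-1 <= w.
  by move: hw hl hm; rewrite !ler_norml => /andP[? ?] /andP[? ?] /andP[? ?]; lra.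
have w0 : 0 < w by lra.
set P := (X in _ - X).
have hll := M _ _ _ _ hl hl.
have hul := M _ _ _ _ hu hl.
have huu := M _ _ _ _ hu hu.
have hP : `|P| <= 3.
  move: hll hul huu hu hl hm; rewrite !ler_norml /P !expr2.
  by move=> /andP[? ?] /andP[? ?] /andP[? ?] /andP[? ?] /andP[? ?] /andP[? ?]; lra.
have hwP := M _ _ _ _ hw hP.
(* Give [u], [l] weight 1 and [m] weight 2. All terms of weight at most 2 cancel; weight 3 leaves at
   most [4 r^3], weight 4 at most [3/2 r^4], absorbed by [r43]. *)
have hrem : `|(1 + l + m / 2) * P - (1 + u + u ^+ 2 / 2)| <= 5 * r ^+ 3.
  move: (M _ _ _ _ hm hu) (M _ _ _ _ hl huu) (M _ _ _ _ hm huu)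
    (M _ _ _ _ hm hl) (M _ _ _ _ hm hm) (M _ _ _ _ hm hll) (M _ _ _ _ hm hul)
    (M _ _ _ _ hl hll) (M _ _ _ _ hl hul).
  rewrite !ler_norml /P.
  move=> /andP[? ?] /andP[? ?] /andP[? ?] /andP[? ?] /andP[? ?] /andP[? ?].
  by move=> /andP[? ?] /andP[? ?] /andP[? ?]; lra.
have -> : x / w - P = (x - w * P) / w by field; rewrite gt_eqF.
rewrite normrM normfV (gtr0_norm w0) ler_pdivrMr //.
(* 13 = 2 + 6 + 5, from [hx], [hwP] and [hrem]; dividing by [w >= 1/2] doubles it to 26. *)
apply: (@le_trans _ _ (13 * r ^+ 3)); last by nra.
move: hx hwP hrem; rewrite !ler_norml.
by move=> /andP[? ?] /andP[? ?] /andP[? ?]; lra.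
Qed.

Lemma ord_shift_inj (n j : nat) : injective (fun i : 'I_n => ord_shift i j).
Proof.
move=> a b /(congr1 val) /= /eqP; rewrite eqn_modDr !modn_small // => /eqP.
exact: val_inj.
Qed.

(** For each of the [k] offsets, the cyclic shift permutes the indices and so preserves the full
    sum. *)
Lemma sum_window_sum (R : realType) (n k : nat) (v : 'rV[R]_n) :
  \sum_(i < n) window_sum k v i = k%:R * \sum_(i < n) v 0 i.
Proof.
rewrite /window_sum exchange_big /=.
under eq_bigr => j _ do
  rewrite -(reindex_inj (@ord_shift_inj n j) (P := xpredT) (F := fun i => v 0 i)).
by rewrite sumr_const_nat subn1 mulr_natl.
Qed.

Lemma window_sum_mean_le (R : realType) (n k : nat) (v : 'rV[R]_n) (i : 'I_n)
    (B : R) : (0 < k)%N -> (forall j, `|v 0 j| <= B) ->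
  `|window_sum k v i / k%:R| <= B.
Proof.
move=> k0 vB; rewrite normrM normfV normr_nat ler_pdivrMr ?ltr0n //.
rewrite (le_trans (ler_norm_sum _ _ _)) //.
rewrite (le_trans (ler_sum _ (fun j _ => vB _))) //.
by rewrite sumr_const_nat subn1 mulr_natr.
Qed.

(** Transfers the sup-norm estimate to the Euclidean norm: a nonzero sup norm is attained at an
    entry, whose square is one term under the root. *)
Lemma norm_le_euclidean (R : realType) (n : nat) (u : 'rV[R]_n) :
  `|u| <= euclidean_norm u.
Proof.
have [->|/mx_norm_neq0[[a i] /= uE]] := eqVneq `|u| 0; first exact: sqrtr_ge0.
rewrite [leLHS]uE -sqrtr_sqr ler_wsqrtr // (bigD1 i) //= (ord1 a) lerDl.
by apply: sumr_ge0 => j _; exact: sqr_ge0.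
Qed.

Lemma cyclic_sum_expansion (R : realType) (n k : nat) (u : 'rV[R]_n) :
  (0 < k)%N -> \sum_(i < n) u 0 i = 0 -> `|u| <= 4^-1 ->
  `|cyclic_sum k (exp_row u) - (n%:R / k%:R + quadratic_term k u)|
    <= n%:R * 26 / k%:R * `|u| ^+ 3.
Proof.
move=> k0 u0 u4.
have kN : k%:R != 0 :> R by rewrite pnatr_eq0 -lt0n.
have hu j : `|u 0 j| <= `|u| by rewrite [leRHS]mx_normrE; exact: (le_bigmax _ (fun ij => `|u ij.1 ij.2|) (0, j)).
pose s : 'rV[R]_n := \row_i (u 0 i ^+ 2).
pose L i := window_sum k u i / k%:R.
pose M i := window_sum k s i / k%:R.
pose T i := 1 + u 0 i + u 0 i ^+ 2 / 2 - L i - M i / 2 + L i ^+ 2 - u 0 i * L i.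
have hT i : `|exp_row u 0 i / window_sum k (exp_row u) i - T i / k%:R|
    <= 26 * `|u| ^+ 3 / k%:R.
  set W := window_sum _ _ _.
  (* Replacing the window sum by the window mean makes the denominator close to 1 and leaves a
     factor [1/k]. *)
  have -> : exp_row u 0 i / W = exp_row u 0 i / (W / k%:R) / k%:R.
    by rewrite invf_div mulrA [RHS]mulrAC mulfK.
  rewrite -mulrBl.
  rewrite normrM normfV normr_nat ler_pM2r ?invr_gt0 ?ltr0n //.
  have he j : `|expR (u 0 j) - (1 + u 0 j + u 0 j ^+ 2 / 2)| <= 2 * `|u| ^+ 3.
    apply: le_trans (expR_taylor2 _ _ _) _; first by rewrite (le_trans (hu j)) //; lra.
    by apply: ler_wpM2l => //; apply: lerXn2r; rewrite ?nnegrE.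
  apply: quotient_taylor2 => //.
  - exact: window_sum_mean_le.
  - apply: window_sum_mean_le => // j; rewrite mxE normrX.
    by apply: lerXn2r; rewrite ?nnegrE.
  - by rewrite mxE.
  - pose e : 'rV[R]_n := \row_j (expR (u 0 j) - (1 + u 0 j + u 0 j ^+ 2 / 2)).
    have -> : W / k%:R - (1 + L i + M i / 2) = window_sum k e i / k%:R.
      have -> : window_sum k e i = W - (k%:R + window_sum k u i + window_sum k s i / 2).
        rewrite /W /window_sum mulr_suml.
        have -> : k%:R = \sum_(1 <= j < k.+1) (1 : R) by rewrite sumr_const_nat subn1.
        by rewrite -!big_split -sumrB /=; apply: eq_bigr => j _; rewrite !mxE.
      by rewrite /L /M; field.
    by apply: window_sum_mean_le => // j; rewrite mxE.
(* The means in [L i ^+ 2] and [u 0 i * L i] contribute [k^-2] and [k^-1]; the outer [1/k] turns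
   these into the coefficients of [quadratic_term]. *)
have -> : n%:R / k%:R + quadratic_term k u = \sum_(i < n) T i / k%:R.
  rewrite -mulr_suml /T !(big_split, sumrN) /= -!mulr_suml.
  rewrite !sum_window_sum u0 sumr_const card_ord.
  under [\sum_(i < n) s 0 i]eq_bigr do rewrite mxE.
  rewrite /quadratic_term /L.
  under [\sum_(i < n) (_ / _) ^+ 2]eq_bigr do rewrite expr_div_n.
  under [\sum_(i < n) (_ * (_ / _))]eq_bigr do rewrite mulrA.
  by rewrite -!mulr_suml; field.
rewrite /cyclic_sum -sumrB (le_trans (ler_norm_sum _ _ _)) //.
rewrite (le_trans (ler_sum _ (fun i _ => hT i))) //.
by rewrite sumr_const card_ord -mulr_natl le_eqVlt; apply/orP; left; apply/eqP; field.
Qed.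

Theorem lemma3p1 (R : realType) (n k : nat) (hn : (2 <= n)%N)
    (hk1 : (1 <= k)%N) (hk2 : (k <= n.-1)%N) :
  (fun u : 'rV[R]_n => cyclic_sum k (exp_row u))
  = (fun u => n%:R / k%:R + quadratic_term k u)
    +O_ (within (@zero_sum R n) (nbhs (0 : 'rV[R]_n)))
      (fun u => euclidean_norm u ^+ 3).
Proof.
have small : \forall u \near (0 : 'rV[R]_n), `|u| <= 4^-1 by exact: nbhs0_le.
(* Any [C] above [26 n / k] works, on the ball of radius 1/4 in the sup norm. *)
apply/eqaddOP; near=> C; rewrite near_withinE; near=> u => u0.
have u4 : `|u| <= 4^-1 by near: u; exact: small.
apply: le_trans (cyclic_sum_expansion _ _ _ _ hk1 u0 u4) _.
apply: ler_pM => //.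
rewrite ger0_norm ?exprn_ge0 ?sqrtr_ge0 //.
by apply: lerXn2r; rewrite ?nnegrE ?sqrtr_ge0 // norm_le_euclidean.
Unshelve.
all: by end_near.
Qed.
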